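(* Let $S$ be a numerical semigroup with multiplicity $m$. Let $h\ge 1$, let $a_1,\dots,a_h$ be pairwise distinct gaps of $S$ with $a_i<m$ for every $i$, and let $E=\{0,a_1,\dots,a_h\}+S\in\mathcal{I}_0(S)$. Then $\mathrm{r}(E)\le m-h$.
   Context: $\mathbb{N}$ denotes the non-negative integers. A numerical semigroup $S$ is a submonoid of $(\mathbb{N},+)$ with finite complement in $\mathbb{N}$; the elements of $\mathbb{N}\setminus S$ are its gaps. The multiplicity $m$ of $S$ is its smallest positive element. For a set $X$ of integers, $X+S=\{x+s: x\in X, s\in S\}$. $\mathcal{I}_0(S)=\{E\subseteq\mathbb{N}: E+S\subseteq E,\ \min(E)=0\}$ is the set of ideals of $S$ with minimum $0$; it is a monoid under $I+J=\{a+b: a\in I, b\in J\}$. For a positive integer $k$, $kI$ denotes the $k$-fold sum $I+\dots+I$. The reduction number $\mathrm{r}(I)$ of $I\in\mathcal{I}_0(S)$ is the smallest positive integer $r$ such that $(r+1)I=rI$. *)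

(* Defs.v *)
From mathcomp Require Import all_boot.
From mathcomp Require Import boolp classical_sets functions cardinality.

Set Implicit Arguments.
Unset Strict Implicit.
Unset Printing Implicit Defensive.

Local Open Scope classical_set_scope.
Local Open Scope nat_scope.

Definition sumset (A B : set nat) : set nat := [set a + b | a in A & b in B].

(* [nfold_sumset k A] is A + (A + ... + A) with k summands; like [x *+ n], it is
   [A] itself for k = 1, and the neutral element [set 0] for k = 0. *)
Definition nfold_sumset (k : nat) (A : set nat) : set nat :=
  iterop k sumset A [set 0].

Record numerical_semigroup := NumericalSemigroup {
  semigroup_set :> set nat;
  semigroup0 : semigroup_set 0;
  semigroupD : forall x y,
    semigroup_set x -> semigroup_set y -> semigroup_set (x + y);
  semigroup_cofinite : finite_set (~` semigroup_set) }.

Definition gaps (S : numerical_semigroup) : set nat := ~` S.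

Lemma semigroup_pos_ex (S : numerical_semigroup) :
  exists n, (0 < n) && (n \in (S : set nat)).
Proof.
apply: contrapT => noS; apply: infinite_nat.
rewrite -(setUv S) finite_setU; split; last exact: semigroup_cofinite.
apply: (sub_finite_set _ (finite_set1 0)) => n Sn /=.
apply: contrapT => n0; apply: noS; exists n.
by apply/andP; split; [rewrite lt0n; apply/eqP | exact: mem_set].
Qed.

Definition multiplicity (S : numerical_semigroup) : nat :=
  ex_minn (semigroup_pos_ex S).

(* The set I_0(S); for a subset of nat, having minimum 0 means containing 0. *)
Record ideal0 (S : numerical_semigroup) := Ideal0 {
  ideal0_set :> set nat;
  ideal0_sub : sumset ideal0_set S `<=` ideal0_set;
  ideal0_min : ideal0_set 0 }.

Lemma sumset_ideal0 (S : numerical_semigroup) (X : set nat) :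
  X 0 -> exists E : ideal0 S, E = sumset X S :> set nat.
Proof.
move=> X0.
have sub : sumset (sumset X S) S `<=` sumset X S.
  move=> _ [_ [x Xx [s Ss <-]] [t St <-]].
  by exists x => //; exists (s + t); [exact: semigroupD | rewrite addnA].
have min : sumset X S 0.
  by exists 0 => //; exists 0; rewrite ?addn0//; exact: semigroup0.
by exists (Ideal0 sub min).
Qed.

Lemma nfold_sumsetS k A : nfold_sumset k.+2 A = sumset A (nfold_sumset k.+1 A).
Proof. by []. Qed.

Lemma nfold_sumset_homo (A : set nat) j k : A 0 -> 0 < j -> j <= k ->
  nfold_sumset j A `<=` nfold_sumset k A.
Proof.
move=> A0 j0; elim: k => [|k IH]; first by rewrite leqn0; case: j j0.
rewrite leq_eqVlt => /predU1P[->//|]; rewrite ltnS => jk.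
case: k IH jk => [|k] IH jk; first by move: (leq_trans j0 jk).
move=> x /(IH jk) kx; rewrite nfold_sumsetS.
by exists 0 => //; exists x.
Qed.

Lemma reduction_number_ex (S : numerical_semigroup) (I : ideal0 S) :
  exists r, (0 < r) && `[< nfold_sumset r.+1 I = nfold_sumset r I >].
Proof.
have [I0 SI] : (I : set nat) 0 /\ S `<=` I.
  split=> [|s Ss]; first exact: ideal0_min.
  by apply: ideal0_sub; exists 0; [exact: ideal0_min | exists s].
have [N SN] : exists N, forall x, N <= x -> semigroup_set S x.
  have /finite_seqP[s Es] := semigroup_cofinite S.
  exists (\max_(x <- s) x).+1 => x sx; apply: contrapT => nSx.
  have : x \in s by have : (~` S) x by []; rewrite Es.
  by move=> xs; move: (@leq_bigmax_seq _ s predT id x xs isT); rewrite leqNgt sx.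
have [r r0 rP] : exists2 r, 0 < r &
    forall x, x < N -> forall k, 0 < k ->
      nfold_sumset k I x -> nfold_sumset r I x.
  elim: (N) => [|M [r r0 rP]]; first by exists 1.
  have [[k k0 kM]|nM] := pselect (exists2 k, 0 < k & nfold_sumset k I M).
    exists (maxn r k) => [|x]; first by rewrite leq_max r0.
    rewrite ltnS leq_eqVlt => /predU1P[-> _ _ _|xM j j0 jx].
      by apply: nfold_sumset_homo kM; rewrite ?leq_maxr.
    by apply: nfold_sumset_homo (rP _ xM _ j0 jx); rewrite ?leq_maxl.
  exists r => // x; rewrite ltnS leq_eqVlt => /predU1P[-> k k0 kM|xM].
    by case: nM; exists k.
  exact: rP.
exists r; rewrite r0; apply/asboolP/seteqP; split=> [x|]; last first.
  exact: nfold_sumset_homo.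
have [xN|Nx _] := ltnP x N; first exact: rP.
by apply: (@nfold_sumset_homo I 1) => //; exact/SI/SN.
Qed.

Definition reduction_number (S : numerical_semigroup) (I : ideal0 S) : nat :=
  ex_minn (reduction_number_ex I).

(* Main.v *)
Require Import Defs.
From mathcomp Require Import all_boot.
From mathcomp Require Import boolp classical_sets functions cardinality.

(* Write an element of (r+1)E, where r = m - h, as a sum of r + 1 elements of E,
   with partial sums s_1, ..., s_(r+1). If s_i = s_j modulo m with i < j, then
   s_j - s_i lies in S and s_j in iE; if s_j = a modulo m with a = 0 or a = a_i,
   then s_j - a lies in S and s_j in E. One of the two must happen for some
   j >= 2, since s_2, ..., s_(r+1), 0, a_1, ..., a_h are m + 1 numbers. So s_j,
   which uses j summands, is in (j-1)E, and the whole sum is in rE. *)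

Local Open Scope classical_set_scope.
Local Open Scope nat_scope.

(** [iterop] treats one summand separately; [A + {0} = A] extends the recursion to [k = 0], so
    inductions can start from the empty sum. *)
Lemma nfold_sumset_recl k A :
  nfold_sumset k.+1 A = sumset A (nfold_sumset k A).
Proof.
case: k => [|k] //; apply/seteqP; split=> [x Ax|_ [x Ax [_ -> <-]]].
  by exists x => //; exists 0; rewrite ?addn0.
by rewrite addn0.
Qed.

Lemma nfold_sumset_sumn (A : set nat) (s : seq nat) :
  (forall x, x \in s -> A x) -> nfold_sumset (size s) A (sumn s).
Proof.
elim: s => [|x s IH] As //; rewrite [size _]/= nfold_sumset_recl.
exists x; first by apply: As; rewrite mem_head.
by exists (sumn s) => //; apply: IH => y ys; apply: As; rewrite inE ys orbT.
Qed.

(** Having the summands as a list makes partial sums available through [take] and [drop]. *)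
Lemma nfold_sumset_seq k (A : set nat) x : nfold_sumset k A x ->
  exists s, [/\ size s = k, forall y, y \in s -> A y & sumn s = x].
Proof.
elim: k x => [|k IH] x; first by move=> ->; exists [::].
rewrite nfold_sumset_recl => -[y Ay [z /IH[s [<- As <-]] <-]].
by exists (y :: s); split=> // t; rewrite inE => /predU1P[->|/As].
Qed.

Lemma nfold_sumsetD j k A x y :
  nfold_sumset j A x -> nfold_sumset k A y -> nfold_sumset (j + k) A (x + y).
Proof.
move=> /nfold_sumset_seq[s [<- As <-]] /nfold_sumset_seq[t [<- At <-]].
rewrite -size_cat -sumn_cat; apply: nfold_sumset_sumn => z.
by rewrite mem_cat => /orP[/As|/At].
Qed.

(** One summand absorbs [y], hence [0 < k]: the empty sum cannot. *)
Lemma nfold_sumset_ideal (S : numerical_semigroup) (I : ideal0 S) k x y :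
  0 < k -> nfold_sumset k I x -> semigroup_set S y -> nfold_sumset k I (x + y).
Proof.
case: k => // k _; rewrite nfold_sumset_recl => -[u Iu [v Iv <-]] Sy.
exists (u + y); last by exists v; rewrite // addnAC.
by apply: ideal0_sub; exists u => //; exists y.
Qed.

Lemma semigroup_mul (S : numerical_semigroup) x q :
  semigroup_set S x -> semigroup_set S (q * x).
Proof.
move=> Sx; elim: q => [|q IH]; first exact: semigroup0.
by rewrite mulSn; apply: semigroupD.
Qed.

Lemma semigroup_sub_eqmod (S : numerical_semigroup) m x y :
  semigroup_set S m -> x <= y -> x = y %[mod m] -> semigroup_set S (y - x).
Proof.
move=> Sm xy exy; suff /dvdnP[q ->] : m %| y - x by apply: semigroup_mul.
by rewrite -eqn_mod_dvd//; apply/eqP.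
Qed.

Lemma multiplicityP (S : numerical_semigroup) :
  0 < multiplicity S /\ semigroup_set S (multiplicity S).
Proof.
by rewrite /multiplicity; case: ex_minnP => n /andP[n0 /set_mem].
Qed.

(** The reverse inclusion is automatic because [0] is in [I]. *)
Lemma reduction_number_le (S : numerical_semigroup) (I : ideal0 S) r : 0 < r ->
  nfold_sumset r.+1 I `<=` nfold_sumset r I -> reduction_number I <= r.
Proof.
move=> r0 rI; rewrite /reduction_number; case: ex_minnP => n _; apply.
rewrite r0; apply/asboolP/seteqP; split=> //.
by apply: nfold_sumset_homo => //; exact: ideal0_min.
Qed.

Theorem proposition4p16 (S : numerical_semigroup) (h : nat) (h_ge1 : 1 <= h)
    (a : 'I_h -> nat) (a_inj : injective a)
    (a_gap : forall i, gaps S (a i))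
    (a_lt : forall i, a i < multiplicity S)
    (E : ideal0 S)
    (E_def : E = sumset ([set 0] `|` range a) S :> set nat) :
  reduction_number E <= multiplicity S - h.
Proof.
have [m0 Sm] := multiplicityP S; set m := multiplicity S in a_lt m0 Sm *.
pose A := 0 :: [seq a i | i <- enum 'I_h].
have sizeA : size A = h.+1 by rewrite /= size_map size_enum_ord.
have uniqA : uniq A.
  rewrite /= (map_inj_uniq a_inj) enum_uniq andbT.
  by apply/mapP => -[i _ ai0]; apply: (a_gap i); rewrite -ai0; exact: semigroup0.
have ltA x : x \in A -> x < m.
  by rewrite inE => /predU1P[->//|/mapP[i _ ->]].
have size_lt_m t : uniq t -> (forall x, x \in t -> x < m) -> size t <= m.
  move=> ut tm; rewrite -(size_iota 0 m); apply: uniq_leq_size => // x /tm.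
  by rewrite mem_iota.
(* The [h + 1] entries of [A] are distinct and below [m]; this makes the bound [m - h] positive. *)
have hm : h < m by rewrite -sizeA; apply: size_lt_m.
have EA x s : x \in A -> semigroup_set S s -> (E : set nat) (x + s).
  move=> xA Ss; rewrite E_def; exists x; last by exists s.
  by move: xA; rewrite inE => /predU1P[->|/mapP[i _ ->]]; [left | right; exists i].
apply: reduction_number_le => [|x]; first by rewrite subn_gt0.
move=> /nfold_sumset_seq[s [size_s Es <-]].
pose sigma j := sumn (take j s).
have sigmaE j : j <= size s -> nfold_sumset j E (sigma j).
  move=> js; rewrite -{1}(size_takel js); apply: nfold_sumset_sumn => y.
  by move=> /mem_take/Es.
(* Using [i < j] summands for [sigma j] and keeping the other [size s - j] saves at least one of the
   [m - h + 1]. *)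
suff [j [j1 js [i [i0 ij sE]]]] : exists j, [/\ 1 < j, j <= size s &
    exists i, [/\ 0 < i, i < j & nfold_sumset i E (sigma j)]].
  rewrite -(cat_take_drop j s) sumn_cat.
  have dropE : nfold_sumset (size s - j) E (sumn (drop j s)).
    by rewrite -size_drop; apply: nfold_sumset_sumn => y /mem_drop/Es.
  apply: nfold_sumset_homo (nfold_sumsetD _ _ _ _ _ sE dropE).
  - exact: ideal0_min.
  - by rewrite addn_gt0 i0.
  - by rewrite -ltnS -size_s -[X in _ < X](subnKC js) ltn_add2r.
apply: contrapT => noj.
(* The indices 2, ..., [m - h + 1]; index 1 is left out because [sigma 1] cannot be written with
   fewer than one summand. *)
pose J := iota 2 (m - h).
have JP j : j \in J -> 1 < j /\ j <= size s.
  by rewrite mem_iota size_s addSn ltnS => /andP[].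
have sigma_neq i j : i \in J -> j \in J -> i < j ->
    sigma i <> sigma j %[mod m].
  move=> /JP[i1 si] /JP[j1 js] ij eij; apply: noj; exists j; split=> //.
  exists i; split=> //; first exact: ltnW.
  have sij : sigma i <= sigma j.
    rewrite /sigma -(subnKC (ltnW ij)) takeD sumn_cat; exact: leq_addr.
  rewrite -(subnKC sij); apply: nfold_sumset_ideal; first exact: ltnW.
    exact: sigmaE.
  exact: semigroup_sub_eqmod Sm sij eij.
(* This list has [(m - h) + (h + 1) = m + 1] entries, so the bound is absurd. *)
have : size ([seq sigma j %% m | j <- J] ++ A) <= m.
  apply: size_lt_m => [|y]; last first.
    by rewrite mem_cat => /orP[/mapP[j _ ->]|/ltA//]; rewrite ltn_pmod.
  rewrite cat_uniq uniqA andbT; apply/andP; split.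
    rewrite map_inj_in_uniq ?iota_uniq// => i j iJ jJ eij.
    by case: (ltngtP i j) => // [/sigma_neq|/sigma_neq] /(_ _ _)[].
  (* A residue [y] of [sigma j] lying in [A] puts [sigma j], which is [y] plus a multiple of [m], in
     [E]: take [i = 1]. *)
  apply/hasPn => y yA; apply/mapP => -[j /JP[j1 js] yj].
  apply: noj; exists j; split=> //; exists 1; split=> //.
  rewrite [sigma j](divn_eq _ m) -yj addnC; apply: EA => //.
  exact: semigroup_mul.
by rewrite size_cat size_map size_iota sizeA addnS subnK ?ltnn// ltnW.
Qed.
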